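(* Let $\Bbbk$ be a commutative ring with unit, let $(H^+,H^-)$ be a dual pair of Hopf algebras over $\Bbbk$, and let $\mathfrak{h}=\mathfrak{h}(H^+,H^-)$ be the Heisenberg double of $H^+$. Let $X^+$ be a (unital) subalgebra of $H^+$ that is invariant under the left-regular action of $H^-$ on $H^+$, so that $X^+\# H^-$ is a subalgebra of $\mathfrak{h}$ acting naturally on $X^+$. (1) The only $(X^+\# H^-)$-submodules of $X^+$ are those of the form $IX^+$ for some ideal $I$ of $\Bbbk$. In particular, if $\Bbbk$ is a field, then $X^+$ is irreducible as an $(X^+\# H^-)$-module. (2) Let $\Bbbk^-\cong\Bbbk$ (isomorphism of $\Bbbk$-modules) be the representation of $H^-$ such that $H^-_n$ acts as zero for all $n>0$ and $H^-_0\cong\Bbbk$ acts by left multiplication. Then $X^+$ is isomorphic to the induced module $\mathrm{Ind}^{X^+\# H^-}_{H^-}\Bbbk^- = (X^+\# H^-)\otimes_{H^-}\Bbbk^-$ as an $(X^+\# H^-)$-module. (3) Any $(X^+\# H^-)$-module generated by a lowest weight vacuum vector is isomorphic to $X^+$. (4) If $X^+=H^+$, then $X^+\# H^-=\mathfrak{h}$, the module $X^+$ is the lowest weight Fock space representation $\mathcal{F}$ of $\mathfrak{h}$, and $\mathcal{F}$ is a faithful representation of $\mathfrak{h}$.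
   Context: All algebras, coalgebras and tensor products are over $\Bbbk$. A graded connected Hopf algebra is a bialgebra $H=\bigoplus_{n\in\mathbb{N}}H_n$ with each $H_n$ a finitely generated free $\Bbbk$-module, such that $H_kH_\ell\subseteq H_{k+\ell}$, $\Delta(H_k)\subseteq\bigoplus_{j=0}^k H_j\otimes H_{k-j}$, $\varepsilon(H_k)=0$ for $k>0$, and $H_0=\Bbbk 1_H$ (such a bialgebra automatically has an antipode). A Hopf pairing $\langle\cdot,\cdot\rangle\colon H\times H'\to\Bbbk$ is a bilinear map with $\langle ab,x\rangle=\sum\langle a,x_{(1)}\rangle\langle b,x_{(2)}\rangle$, $\langle a,xy\rangle=\sum\langle a_{(1)},x\rangle\langle a_{(2)},y\rangle$, $\langle 1,x\rangle=\varepsilon(x)$, $\langle a,1\rangle=\varepsilon(a)$ (Sweedler notation). $(H^+,H^-)$ is a dual pair if $H^\pm$ are graded connected Hopf algebras that are graded dual to each other (as Hopf algebras) via a Hopf pairing $\langle\cdot,\cdot\rangle\colon H^-\times H^+\to\Bbbk$; i.e. $H^-_m$ and $H^+_n$ are orthogonal for $m\ne n$ and $H^-_n\times H^+_n\to\Bbbk$ is perfect for each $n$. For $x\in H^-$, ${}^Rx^*\in\mathrm{End}_\Bbbk H^+$ denotes the adjoint of right multiplication by $x$: $\langle y,{}^Rx^*(a)\rangle=\langle yx,a\rangle$ for $y\in H^-$, $a\in H^+$. The action $x\mapsto{}^Rx^*$ of $H^-$ on $H^+$ is the left-regular action. The Heisenberg double $\mathfrak{h}(H^+,H^-)$ is $H^+\otimes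 H^-$ as a $\Bbbk$-module, with $a\otimes x$ written $a\# x$, and multiplication $(a\# x)(b\# y)=\sum_{(x)}a\,{}^Rx_{(1)}^*(b)\# x_{(2)}y$. $H^+$ and $H^-$ are viewed as subalgebras via $a\mapsto a\#1$, $x\mapsto 1\# x$. $X^+\# H^-$ is the $\Bbbk$-span of the $a\# x$ with $a\in X^+$, $x\in H^-$. The natural action is $(a\# x)(b)=a\,{}^Rx^*(b)$; for $X^+=H^+$ this is the lowest weight Fock space representation $\mathcal{F}$. A lowest weight vacuum vector in a module $V$ over $X^+\#H^-$ is an element $v\in V$ such that $\Bbbk v\cong\Bbbk$ (as $\Bbbk$-modules) and $H^-_nv=0$ for all $n>0$.
   Formalization: The first sentence of (1) is false for general k (e.g. k=F_2[t], H^±=k[x]/(x^2), X^+=k+tkx, submodule tk+tkx); it is stated for X^+ with X^+ ∩ IH^+ ⊆ IX^+ for all ideals I of k, a condition that is also necessary. *)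

(* Defs.v *)
From HB Require Import structures.
From mathcomp Require Import all_boot all_algebra.
From mathcomp Require Import boolp.

Set Implicit Arguments.
Unset Strict Implicit.
Unset Printing Implicit Defensive.

Import GRing.Theory.
Local Open Scope ring_scope.
Local Open Scope quotient_scope.

Section Tensor.

(* The tensor product of M and N balanced over a set S of scalars that acts on
   M by ract (additively and R-linearly) and on N by lact. *)
Variables (R : pzRingType) (S : Type) (M : lmodType R) (N : zmodType).
Variables (ract : S -> {linear M -> M}) (lact : S -> N -> N).

Definition balanced (P : zmodType) (f : M -> N -> P) : Prop :=
  [/\ forall m m' n, f (m + m') n = f m n + f m' n,
      forall m n n', f m (n + n') = f m n + f m n' &
      forall s m n, f (ract s m) n = f m (lact s n)].

Definition formal_sum (P : zmodType) (f : M -> N -> P) (s : seq (M * N)) : P :=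
  \sum_(p <- s) f p.1 p.2.

(* Two formal sums of pairs are identified when no balanced map separates them,
   that is, when they differ by a consequence of the balancing relations. *)
Definition tensor_rel : rel (seq (M * N)) := fun s t =>
  `[< forall (P : zmodType) (f : M -> N -> P),
        balanced f -> formal_sum f s = formal_sum f t >].

Lemma tensor_rel_equiv : equiv_class_of tensor_rel.
Proof.
split=> [s|s t|t s u /asboolP st /asboolP tu]; first by apply/asboolP.
  by apply/asboolP/asboolP=> H P f /H.
by apply/asboolP=> P f bf; rewrite st // tu.
Qed.

Canonical tensor_equiv := EquivRelPack tensor_rel_equiv.

Definition tensor : Type := {eq_quot tensor_equiv}.
HB.instance Definition _ := Choice.on tensor.

Definition to_tensor (s : seq (M * N)) : tensor := \pi_({eq_quot tensor_equiv}) s.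
Definition pure_tensor (m : M) (n : N) : tensor := to_tensor [:: (m, n)].
Definition tensor_repr (t : tensor) : seq (M * N) :=
  repr (t : {eq_quot tensor_equiv}).

(* Meaningful only when f is balanced: f is applied to a chosen representative. *)
Definition tensor_lift (P : zmodType) (f : M -> N -> P) (t : tensor) : P :=
  formal_sum f (tensor_repr t).

Lemma tensor_reprK t : to_tensor (tensor_repr t) = t.
Proof. exact: reprK. Qed.

Lemma to_tensorP s t : (to_tensor s = to_tensor t) <->
  (forall (P : zmodType) (f : M -> N -> P),
     balanced f -> formal_sum f s = formal_sum f t).
Proof.
split=> [/eqmodP/asboolP //|H]; apply/eqmodP/asboolP => //.
Qed.

Lemma tensor_lift_to (P : zmodType) (f : M -> N -> P) s :
  balanced f -> tensor_lift f (to_tensor s) = formal_sum f s.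
Proof. by move=> bf; apply: (to_tensorP _ _).1 bf; rewrite tensor_reprK. Qed.

Let tzero := to_tensor [::].
Let topp t := to_tensor [seq (- p.1, p.2) | p <- tensor_repr t].
Let tadd t u := to_tensor (tensor_repr t ++ tensor_repr u).
Let tscale (r : R) t := to_tensor [seq (r *: p.1, p.2) | p <- tensor_repr t].

Lemma tensor_ext t u :
  (forall (P : zmodType) (f : M -> N -> P), balanced f ->
     tensor_lift f t = tensor_lift f u) -> t = u.
Proof.
by move=> H; rewrite -(tensor_reprK t) -(tensor_reprK u); apply/to_tensorP.
Qed.

Let lift0 (P : zmodType) (f : M -> N -> P) : balanced f ->
  tensor_lift f tzero = 0.
Proof. by move=> bf; rewrite tensor_lift_to // /formal_sum big_nil. Qed.

Let liftD (P : zmodType) (f : M -> N -> P) t u : balanced f ->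
  tensor_lift f (tadd t u) = tensor_lift f t + tensor_lift f u.
Proof. by move=> bf; rewrite tensor_lift_to // /formal_sum big_cat. Qed.

Lemma balancedNl (P : zmodType) (f : M -> N -> P) m n : balanced f ->
  f (- m) n = - f m n.
Proof.
move=> [fD _ _]; apply/eqP; rewrite -addr_eq0 -fD addNr.
by apply/eqP/(addrI (f 0 n)); rewrite -fD !addr0.
Qed.

Let liftN (P : zmodType) (f : M -> N -> P) t : balanced f ->
  tensor_lift f (topp t) = - tensor_lift f t.
Proof.
move=> bf; rewrite tensor_lift_to // /formal_sum big_map /= -sumrN.
by apply: eq_bigr => p _; rewrite balancedNl.
Qed.

Lemma balanced_scale (P : zmodType) (f : M -> N -> P) r : balanced f ->
  balanced (fun m n => f (r *: m) n).
Proof.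
by case=> fl fr fb; split=> *; rewrite ?scalerDr ?fl ?fr -?linearZ ?fb.
Qed.

Let liftZ (P : zmodType) (f : M -> N -> P) r t : balanced f ->
  tensor_lift f (tscale r t) = tensor_lift (fun m n => f (r *: m) n) t.
Proof. by move=> bf; rewrite tensor_lift_to // /formal_sum big_map. Qed.

Let taddA : associative tadd.
Proof. by move=> t u v; apply: tensor_ext => P f bf; rewrite !liftD // addrA. Qed.
Let taddC : commutative tadd.
Proof. by move=> t u; apply: tensor_ext => P f bf; rewrite !liftD // addrC. Qed.
Let tadd0 : left_id tzero tadd.
Proof. by move=> t; apply: tensor_ext => P f bf; rewrite liftD // lift0 // add0r. Qed.
Let taddN : left_inverse tzero topp tadd.
Proof.
by move=> t; apply: tensor_ext => P f bf; rewrite liftD // liftN // lift0 // addNr.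
Qed.

HB.instance Definition _ := GRing.isZmodule.Build tensor taddA taddC tadd0 taddN.

Let tscaleA a b t : tscale a (tscale b t) = tscale (a * b) t.
Proof.
apply: tensor_ext => P f bf; rewrite !liftZ //; last exact: balanced_scale.
by apply: eq_bigr => p _; rewrite scalerA.
Qed.
Let tscale1 : left_id 1 tscale.
Proof.
move=> t; apply: tensor_ext => P f bf; rewrite liftZ //.
by apply: eq_bigr => p _; rewrite scale1r.
Qed.
Let tscaleDr : right_distributive tscale +%R.
Proof.
move=> a t u; apply: tensor_ext => P f bf.
by rewrite liftZ // !liftD // ?liftZ //; apply: balanced_scale.
Qed.
Let tscaleDl t : {morph tscale^~ t : a b / a + b}.
Proof.
move=> a b; apply: tensor_ext => P f bf.
rewrite liftD // !liftZ // /tensor_lift /formal_sum -big_split.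
by apply: eq_bigr => p _ /=; case: bf => fl _ _; rewrite scalerDl fl.
Qed.

HB.instance Definition _ :=
  GRing.Zmodule_isLmodule.Build R tensor tscaleA tscale1 tscaleDr tscaleDl.

Lemma tensor_lift_pure (P : zmodType) (f : M -> N -> P) m n :
  balanced f -> tensor_lift f (pure_tensor m n) = f m n.
Proof. by move=> bf; rewrite tensor_lift_to // /formal_sum big_seq1. Qed.

Lemma tensor_lift_is_additive (P : zmodType) (f : M -> N -> P) :
  balanced f -> zmod_morphism (tensor_lift f).
Proof. by move=> bf t u; rewrite liftD // liftN. Qed.

Lemma tensor_liftZ (P : zmodType) (f : M -> N -> P) r t : balanced f ->
  tensor_lift f (r *: t) = tensor_lift (fun m n => f (r *: m) n) t.
Proof. exact: liftZ. Qed.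

Lemma tensor_lift_sum (P : zmodType) (f : M -> N -> P) I (r : seq I) F :
  balanced f ->
  tensor_lift f (\sum_(i <- r) F i) = \sum_(i <- r) tensor_lift f (F i).
Proof.
move=> bf; pose add := GRing.isZmodMorphism.Build _ _ _ (tensor_lift_is_additive bf).
pose g : {additive tensor -> P} := HB.pack (tensor_lift f) add.
exact: (raddf_sum g).
Qed.

Lemma to_tensorE s : to_tensor s = \sum_(p <- s) pure_tensor p.1 p.2.
Proof.
apply: tensor_ext => P f bf; rewrite tensor_lift_to // tensor_lift_sum //.
by apply: eq_bigr => p _; rewrite tensor_lift_pure.
Qed.

Lemma pure_tensor_balanced : balanced pure_tensor.
Proof.
by split=> *; apply: tensor_ext => P f bf; rewrite ?liftD // !tensor_lift_pure //;
  case: bf => fl fr fb; rewrite ?fl ?fr ?fb.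
Qed.

Lemma pure_tensorZ r m n : pure_tensor (r *: m) n = r *: pure_tensor m n.
Proof.
apply: tensor_ext => P f bf; rewrite tensor_liftZ // !tensor_lift_pure //.
exact: balanced_scale.
Qed.

Lemma tensorE t : t = \sum_(p <- tensor_repr t) pure_tensor p.1 p.2.
Proof. by rewrite -to_tensorE tensor_reprK. Qed.

End Tensor.

Section TensorOverRing.
Variables (k : comNzRingType) (M N : lmodType k).

Definition ktensor : Type :=
  tensor (fun c : k => (c \*: idfun)%R : {linear M -> M}) (fun (c : k) (n : N) => c *: n).
HB.instance Definition _ := GRing.Lmodule.on ktensor.

Definition ktens (m : M) (n : N) : ktensor := pure_tensor _ _ m n.

(* Meaningful only when f is bilinear. *)
Definition tsum (P : zmodType) (f : M -> N -> P) (t : ktensor) : P := tensor_lift f t.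

Definition kbilinear (P : lmodType k) (f : M -> N -> P) : Prop :=
  (forall n, linear (f^~ n)) /\ (forall m, linear (f m)).

End TensorOverRing.

Notation "M ⊗ N" := (ktensor M N) (at level 40, left associativity) : type_scope.
Notation "m ⊗ n" := (ktens m n) (at level 40, left associativity) : ring_scope.
(* Sweedler sums. *)
Notation "\tsum_( x , y <- t ) E" := (tsum (fun x y => E) t)
  (at level 41, x name, y name, t at level 50, E at level 41,
   format "\tsum_( x ,  y  <-  t )  E") : ring_scope.

Section TensorOverRingTheory.
Variables (k : comNzRingType) (M N : lmodType k).

Section Lift.
Variables (P : lmodType k) (f : M -> N -> P).
Hypothesis bf : kbilinear f.

Lemma kbilinear_balanced :
  balanced (fun c : k => (c \*: idfun)%R : {linear M -> M}) (fun (c : k) (n : N) => c *: n) f.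
Proof.
case: bf => fl fr; split=> [m m' n|m n n'|c m n].
- by have := fl n 1 m m'; rewrite !scale1r.
- by have := fr m 1 n n'; rewrite !scale1r.
- by rewrite /= (scalable_linear (fl n)) (scalable_linear (fr m)).
Qed.

Lemma tsum_tens m n : \tsum_(x, y <- m ⊗ n) f x y = f m n.
Proof. exact: tensor_lift_pure kbilinear_balanced. Qed.

Lemma tsum_linear : linear (fun t : M ⊗ N => \tsum_(x, y <- t) f x y).
Proof.
move=> c t u; rewrite /tsum -[u in LHS]opprK (tensor_lift_is_additive kbilinear_balanced).
rewrite tensor_liftZ ?(tensor_lift_is_additive kbilinear_balanced) //; last exact: kbilinear_balanced.
congr (_ + _); last first.
  have /= /(_ 0 u) := tensor_lift_is_additive kbilinear_balanced.
  have /= /(_ 0 0) := tensor_lift_is_additive kbilinear_balanced.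
  by rewrite !subrr => ->; rewrite !sub0r => ->; rewrite opprK.
rewrite /tsum /tensor_lift /formal_sum scaler_sumr; apply: eq_bigr => p _.
by case: bf => fl _; rewrite (scalable_linear (fl _)).
Qed.

End Lift.

Lemma tens_bilinear : kbilinear (@ktens k M N).
Proof.
have [bl br bb] := pure_tensor_balanced (fun c : k => (c \*: idfun)%R : {linear M -> M})
   (fun (c : k) (n : N) => c *: n).
split=> [n|m] c u v.
  by rewrite /ktens bl pure_tensorZ.
by rewrite /ktens br -bb [X in X + _]pure_tensorZ.
Qed.

Lemma tensE (t : M ⊗ N) : t = \tsum_(x, y <- t) x ⊗ y.
Proof. exact: tensorE. Qed.

Lemma tens_ind (Q : M ⊗ N -> Prop) :
  Q 0 -> (forall t u, Q t -> Q u -> Q (t + u)) -> (forall m n, Q (m ⊗ n)) ->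
  forall t, Q t.
Proof.
move=> Q0 QD Qp t; rewrite (tensE t) /tsum /tensor_lift /formal_sum.
by elim/big_ind: _.
Qed.

End TensorOverRingTheory.

Section Hopf.
Variable k : comNzRingType.

Definition kspan (V : lmodType k) (G : V -> Prop) (v : V) : Prop :=
  exists2 s : seq (k * V), (forall p, p \in s -> G p.2) &
    v = \sum_(p <- s) p.1 *: p.2.

Definition finite_free (V : lmodType k) (U : {pred V}) : Prop :=
  exists (d : nat) (b : 'I_d -> V), (forall i, b i \in U) /\
    forall v, v \in U -> exists! c : {ffun 'I_d -> k}, v = \sum_i c i *: b i.

Definition direct_sum (V : lmodType k) (U : nat -> {pred V}) : Prop :=
  (forall v, exists n (f : 'I_n -> V),
     (forall i, f i \in U i) /\ v = \sum_i f i) /\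
  (forall n (f : 'I_n -> V), (forall i, f i \in U i) ->
     \sum_i f i = 0 -> forall i, f i = 0).

Record gradedConnectedHopf := GradedConnectedHopf {
  hopf_alg :> algType k;
  comul : {linear hopf_alg -> (hopf_alg ⊗ hopf_alg)%type};
  counit : {lrmorphism hopf_alg -> k^o};
  deg : nat -> {pred hopf_alg};
  comulA : forall a,
    \tsum_(a1, a2 <- comul a) \tsum_(b, c <- comul a1) b ⊗ (c ⊗ a2) =
    \tsum_(a1, a2 <- comul a) \tsum_(b, c <- comul a2) a1 ⊗ (b ⊗ c);
  counitl : forall a, \tsum_(a1, a2 <- comul a) (counit a1 : k) *: a2 = a;
  counitr : forall a, \tsum_(a1, a2 <- comul a) (counit a2 : k) *: a1 = a;
  comul1 : comul 1 = 1 ⊗ 1;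
  comulM : forall a b, comul (a * b) =
    \tsum_(a1, a2 <- comul a) \tsum_(b1, b2 <- comul b) (a1 * b1) ⊗ (a2 * b2);
  deg_submod : forall n, submod_closed (deg n);
  deg_direct : direct_sum deg;
  deg_free : forall n, finite_free (deg n);
  degM : forall m n a b, a \in deg m -> b \in deg n -> a * b \in deg (m + n);
  deg0E : forall a, a \in deg 0 <-> exists c : k, a = c%:A;
  deg_comul : forall n a, a \in deg n ->
    kspan (fun t => exists j b c,
       [/\ (j <= n)%N, b \in deg j, c \in deg (n - j) & t = b ⊗ c]) (comul a);
  deg_counit : forall n a, (0 < n)%N -> a \in deg n -> counit a = 0
}.

Arguments comul {g}.
Arguments counit {g}.
Arguments deg g n : clear implicits.

Definition linear_on (V : lmodType k) (U : {pred V}) (phi : V -> k) : Prop :=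
  forall c u v, u \in U -> v \in U -> phi (c *: u + v) = c * phi u + phi v.

Definition perfect_on (V W : lmodType k) (U : {pred V}) (T : {pred W})
    (beta : V -> W -> k) : Prop :=
  (forall phi, linear_on T phi ->
     exists! u, u \in U /\ forall w, w \in T -> beta u w = phi w) /\
  (forall phi, linear_on U phi ->
     exists! w, w \in T /\ forall u, u \in U -> beta u w = phi u).

Record dualPair := DualPair {
  Hp : gradedConnectedHopf;
  Hm : gradedConnectedHopf;
  pair : {bilinear Hm -> Hp -> k | *%R & *%R};
  pairMl : forall (x y : Hm) (a : Hp), pair (x * y) a =
    \tsum_(a1, a2 <- comul a) (pair x a1 * pair y a2);
  pairMr : forall (x : Hm) (a b : Hp), pair x (a * b) =
    \tsum_(x1, x2 <- comul x) (pair x1 a * pair x2 b);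
  pair1l : forall a : Hp, pair 1 a = counit a;
  pair1r : forall x : Hm, pair x 1 = counit x;
  pair_orth : forall m n x a,
    m != n -> x \in deg Hm m -> a \in deg Hp n -> pair x a = 0;
  pair_perfect : forall n, perfect_on (deg Hm n) (deg Hp n) pair
}.

End Hopf.

Arguments comul {k g}.
Arguments counit {k g}.
Arguments deg {k} g n.
Arguments pair {k} d.

Section HopfTheory.
Variables (k : comNzRingType).

Lemma linear_sum_of (V W : lmodType k) (g : V -> W) I (r : seq I) F :
  linear g -> g (\sum_(i <- r) F i) = \sum_(i <- r) g (F i).
Proof.
move=> lg; pose l := GRing.isLinear.Build _ _ _ _ g lg.
by pose h : {linear V -> W} := HB.pack g l; exact: (raddf_sum h).
Qed.

Lemma linear_tsum (M N V W : lmodType k) (g : V -> W) (f : M -> N -> V) t :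
  linear g -> g (\tsum_(x, y <- t) f x y) = \tsum_(x, y <- t) g (f x y).
Proof. exact: linear_sum_of. Qed.

Lemma tsum_tsum (M N M' N' P : lmodType k) (f : M -> N -> P)
    (E : M' -> N' -> M ⊗ N) t : kbilinear f ->
  tsum f (\tsum_(x, y <- t) E x y) = \tsum_(x, y <- t) tsum f (E x y).
Proof. by move=> bf; rewrite (linear_tsum _ _ (tsum_linear bf)). Qed.

Lemma eq_tsum (M N P : lmodType k) (f g : M -> N -> P) (t : M ⊗ N) :
  (forall x y, f x y = g x y) -> tsum f t = tsum g t.
Proof. by move=> fg; apply: eq_bigr => p _; rewrite fg. Qed.

Lemma tsumP (M N P : lmodType k) c (f g : M -> N -> P) (t : M ⊗ N) :
  \tsum_(x, y <- t) (c *: f x y + g x y) =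
  c *: (\tsum_(x, y <- t) f x y) + \tsum_(x, y <- t) g x y.
Proof. by rewrite /tsum /tensor_lift /formal_sum big_split /= scaler_sumr. Qed.

Lemma exchange_tsum (M N M' N' P : lmodType k) (f : M -> N -> M' -> N' -> P)
    (t : M ⊗ N) (u : M' ⊗ N') :
  \tsum_(x, y <- t) \tsum_(z, w <- u) f x y z w =
  \tsum_(z, w <- u) \tsum_(x, y <- t) f x y z w.
Proof. exact: exchange_big. Qed.

Lemma tensPl (M N : lmodType k) c (u v : M) (n : N) :
  (c *: u + v) ⊗ n = c *: (u ⊗ n) + v ⊗ n.
Proof. by have [H _] := tens_bilinear M N; apply: H. Qed.

Lemma tensPr (M N : lmodType k) c (m : M) (u v : N) :
  m ⊗ (c *: u + v) = c *: (m ⊗ u) + m ⊗ v.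
Proof. by have [_ H] := tens_bilinear M N; apply: H. Qed.

Lemma mulPl (A : algType k) c (u v w : A) : (c *: u + v) * w = c *: (u * w) + v * w.
Proof. by rewrite mulrDl scalerAl. Qed.

Lemma mulPr (A : algType k) c (u v w : A) : w * (c *: u + v) = c *: (w * u) + w * v.
Proof. by rewrite mulrDr scalerAr. Qed.

Section One.
Variable H : gradedConnectedHopf k.

Lemma tsum_comulM (P : lmodType k) (f : H -> H -> P) x y : kbilinear f ->
  \tsum_(a, b <- comul (x * y)) f a b =
  \tsum_(x1, x2 <- comul x) \tsum_(y1, y2 <- comul y) f (x1 * y1) (x2 * y2).
Proof.
move=> bf; rewrite comulM (tsum_tsum _ _ bf); apply: eq_tsum => x1 x2.
by rewrite (tsum_tsum _ _ bf); apply: eq_tsum => y1 y2; rewrite tsum_tens.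
Qed.

Lemma tsum_comulA (P : lmodType k) (f : H -> H -> H -> P) x :
  (forall b c, linear (fun a => f a b c)) ->
  (forall a c, linear (fun b => f a b c)) ->
  (forall a b, linear (fun c => f a b c)) ->
  \tsum_(a1, a2 <- comul x) \tsum_(b, c <- comul a1) f b c a2 =
  \tsum_(a1, a2 <- comul x) \tsum_(b, c <- comul a2) f a1 b c.
Proof.
move=> l1 l2 l3.
pose F (a : H) (t : (H ⊗ H)%type) := \tsum_(b, c <- t) f a b c.
have bf a : kbilinear (f a) by split.
have bF : kbilinear F.
  split=> [t|a]; last exact: tsum_linear.
  by move=> c u v; rewrite /F -tsumP; apply: eq_tsum => *; rewrite l1.
have := congr1 (tsum F) (comulA x); rewrite !(tsum_tsum _ _ bF).
under eq_tsum => a1 a2.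
  rewrite (tsum_tsum _ _ bF).
  under eq_tsum => b c do rewrite tsum_tens // /F tsum_tens //.
  over.
move=> ->; apply: eq_tsum => a1 a2; rewrite (tsum_tsum _ _ bF).
by apply: eq_tsum => b c; rewrite tsum_tens // /F tsum_tens.
Qed.

Lemma tsum_counitl (P : lmodType k) (f : H -> P) x : linear f ->
  \tsum_(x1, x2 <- comul x) (counit x1 : k) *: f x2 = f x.
Proof.
move=> lf; rewrite -[x in RHS]counitl (linear_tsum _ _ lf).
by apply: eq_tsum => a b; rewrite (scalable_linear lf).
Qed.

Lemma tsum_counitr (P : lmodType k) (f : H -> P) x : linear f ->
  \tsum_(x1, x2 <- comul x) (counit x2 : k) *: f x1 = f x.
Proof.
move=> lf; rewrite -[x in RHS]counitr (linear_tsum _ _ lf).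
by apply: eq_tsum => a b; rewrite (scalable_linear lf).
Qed.
End One.
End HopfTheory.

Section LeftRegular.
Variables (k : comNzRingType) (D : dualPair k).
Local Notation Hp := (Hp D).
Local Notation Hm := (Hm D).
Local Notation "<< x , a >>" := (pair D x a) (format "<< x ,  a >>").
Implicit Types (x y z : Hm) (a b : Hp).

Lemma pairPl c x y a : <<c *: x + y, a>> = c * <<x, a>> + <<y, a>>.
Proof. by rewrite linearPl. Qed.

Lemma pairPr c x a b : <<x, c *: a + b>> = c * <<x, a>> + <<x, b>>.
Proof. by rewrite linearPr. Qed.

Lemma pair_tsumr (M N : lmodType k) x (f : M -> N -> Hp) t :
  <<x, \tsum_(u, v <- t) f u v>> = \tsum_(u, v <- t) <<x, f u v>>.
Proof. exact: linear_sumr. Qed.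

Lemma pair_nondeg a : (forall x, <<x, a>> = 0) -> a = 0.
Proof.
move=> a0; have [n [f [fdeg def_a]]] := (deg_direct Hp).1 a.
rewrite def_a big1 // => i _; have [_ perf] := pair_perfect D i.
have [|b [[_ _] uniq_b]] := perf (fun=> 0); first by move=> *; rewrite mulr0 addr0.
rewrite -(uniq_b (f i)); last first.
  split=> // x xi; rewrite -(a0 x) def_a linear_sumr (bigD1 i) //= big1 ?addr0 //.
  by move=> j nji; apply: pair_orth xi (fdeg j); rewrite eq_sym.
apply: uniq_b; split; first by case: (deg_submod Hp i).
by move=> x _; rewrite linear0r.
Qed.

Lemma pair_inj a b : (forall x, <<x, a>> = <<x, b>>) -> a = b.
Proof.
move=> ab; apply/eqP; rewrite -subr_eq0; apply/eqP/pair_nondeg => x.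
by rewrite linearBr ab subrr.
Qed.

Lemma radj_exists x a : exists b, forall y, <<y, b>> = <<y * x, a>>.
Proof.
exists (\tsum_(a1, a2 <- comul a) <<x, a2>> *: a1) => y.
rewrite pair_tsumr pairMl; apply: eq_bigr => p _.
by rewrite (linearZr_LR (pair D)) /= mulrC.
Qed.

(* radj x is the operator written {}^R x^* on paper. *)
Definition radj x a : Hp := sval (cid (radj_exists x a)).

Lemma pair_radj x a y : <<y, radj x a>> = <<y * x, a>>.
Proof. exact: (svalP (cid (radj_exists x a)) y). Qed.

Lemma radjPl c x y a : radj (c *: x + y) a = c *: radj x a + radj y a.
Proof. by apply: pair_inj => z; rewrite pairPr !pair_radj mulPr pairPl. Qed.

Lemma radjPr c x a b : radj x (c *: a + b) = c *: radj x a + radj x b.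
Proof. by apply: pair_inj => z; rewrite pairPr !pair_radj pairPr. Qed.

Lemma radj_one a : radj 1 a = a.
Proof. by apply: pair_inj => z; rewrite pair_radj mulr1. Qed.

Lemma radj_mul x y a : radj (x * y) a = radj x (radj y a).
Proof. by apply: pair_inj => z; rewrite !pair_radj mulrA. Qed.

Lemma radj1 x : radj x 1 = (counit x : k) *: 1.
Proof.
apply: pair_inj => z; rewrite pair_radj (linearZr_LR (pair D)) /= !pair1r.
by rewrite rmorphM mulrC.
Qed.

Lemma radjM x a b :
  radj x (a * b) = \tsum_(x1, x2 <- comul x) radj x1 a * radj x2 b.
Proof.
apply: pair_inj => y; rewrite pair_radj pairMr pair_tsumr.
rewrite (@tsum_comulM _ _ k^o (fun u v => <<u, a>> * <<v, b>>)); last first.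
  split=> u c v w; rewrite pairPl.
    by rewrite mulrDl -mulrA.
  by rewrite mulrDr mulrCA.
rewrite (@exchange_tsum _ _ _ _ _ k^o); apply: eq_bigr => q _.
by rewrite pairMr; apply: eq_bigr => p _; rewrite !pair_radj.
Qed.

End LeftRegular.

Section Heisenberg.
Variables (k : comNzRingType) (D : dualPair k).
Local Notation Hp := (Hp D).
Local Notation Hm := (Hm D).

Definition heis : Type := (Hp ⊗ Hm)%type.
HB.instance Definition _ := GRing.Lmodule.on heis.

Definition sharp (a : Hp) (x : Hm) : heis := a ⊗ x.
Local Notation "a # x" := (sharp a x) (at level 40).

Definition sharp_mul (a : Hp) (x : Hm) (b : Hp) (y : Hm) : heis :=
  \tsum_(x1, x2 <- comul x) (a * radj x1 b) # (x2 * y).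

Definition heis_mul (al be : heis) : heis :=
  \tsum_(a, x <- al) \tsum_(b, y <- be) sharp_mul a x b y.

Lemma sharpPl c (a b : Hp) x : (c *: a + b) # x = c *: (a # x) + b # x.
Proof. exact: tensPl. Qed.
Lemma sharpPr c (a : Hp) x y : a # (c *: x + y) = c *: (a # x) + a # y.
Proof. exact: tensPr. Qed.

Lemma heis_ind (Q : heis -> Prop) :
  Q 0 -> (forall al be, Q al -> Q be -> Q (al + be)) -> (forall a x, Q (a # x)) ->
  forall al, Q al.
Proof. exact: tens_ind. Qed.

Lemma sharp_mul_body_bilinear a b y :
  kbilinear (fun x1 x2 => (a * radj x1 b) # (x2 * y)).
Proof.
by split=> z c u v; rewrite ?radjPl ?mulPr ?mulPl ?sharpPl ?sharpPr.
Qed.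

Lemma sharp_mulP1 x b y : linear (fun a => sharp_mul a x b y).
Proof.
move=> c u v; rewrite /sharp_mul -tsumP; apply: eq_tsum => x1 x2.
by rewrite mulPl sharpPl.
Qed.
Lemma sharp_mulP2 a b y : linear (fun x => sharp_mul a x b y).
Proof.
move=> c u v; rewrite /sharp_mul linearP.
by rewrite (tsum_linear (sharp_mul_body_bilinear a b y)).
Qed.
Lemma sharp_mulP3 a x y : linear (fun b => sharp_mul a x b y).
Proof.
move=> c u v; rewrite /sharp_mul -tsumP; apply: eq_tsum => x1 x2.
by rewrite radjPr mulPr sharpPl.
Qed.
Lemma sharp_mulP4 a x b : linear (fun y => sharp_mul a x b y).
Proof.
move=> c u v; rewrite /sharp_mul -tsumP; apply: eq_tsum => x1 x2.
by rewrite mulPr sharpPr.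
Qed.

Let bil34 a x : kbilinear (sharp_mul a x).
Proof. by split=> ?; [apply: sharp_mulP3|apply: sharp_mulP4]. Qed.

Let bil12 be : kbilinear (fun a x => \tsum_(b, y <- be) sharp_mul a x b y).
Proof.
split=> ? c u v; rewrite -tsumP; apply: eq_tsum => b y.
  by rewrite sharp_mulP1.
by rewrite sharp_mulP2.
Qed.

Lemma heis_mulPl c u v w :
  heis_mul (c *: u + v) w = c *: heis_mul u w + heis_mul v w.
Proof. exact: (tsum_linear (bil12 w)). Qed.

Lemma heis_mulPr c u v w :
  heis_mul w (c *: u + v) = c *: heis_mul w u + heis_mul w v.
Proof.
rewrite /heis_mul -tsumP; apply: eq_tsum => a x.
exact: (tsum_linear (bil34 a x)).
Qed.

Lemma heis_mulE a x b y : heis_mul (a # x) (b # y) = sharp_mul a x b y.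
Proof. by rewrite /heis_mul (tsum_tens (bil12 _)) (tsum_tens (bil34 _ _)). Qed.

Lemma sharp_mul1l b y : sharp_mul 1 1 b y = b # y.
Proof.
rewrite /sharp_mul comul1 (tsum_tens (sharp_mul_body_bilinear _ _ _)).
by rewrite radj_one !mul1r.
Qed.

Lemma sharp_mul1r a x : sharp_mul a x 1 1 = a # x.
Proof.
rewrite -(@tsum_counitl _ _ _ (fun x => a # x)) => [|c u v]; last exact: sharpPr.
apply: eq_tsum => x1 x2; rewrite radj1 mulr1 -scalerAr mulr1.
by have [tl _] := tens_bilinear Hp Hm; rewrite /sharp (scalable_linear (tl _)).
Qed.

Lemma heis_mul1 : left_id (1 # 1) heis_mul.
Proof.
elim/heis_ind => [|al be IHa IHb|a x].
- by have := heis_mulPr (-1) 0 0 (1 # 1); rewrite !scaler0 addr0 scaleN1r addNr.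
- by have := heis_mulPr 1 al be (1 # 1); rewrite !scale1r IHa IHb.
- by rewrite heis_mulE sharp_mul1l.
Qed.

Lemma heis_mulr1 : right_id (1 # 1) heis_mul.
Proof.
elim/heis_ind => [|al be IHa IHb|a x].
- by have := heis_mulPl (-1) 0 0 (1 # 1); rewrite !scaler0 addr0 scaleN1r addNr.
- by have := heis_mulPl 1 al be (1 # 1); rewrite !scale1r IHa IHb.
- by rewrite heis_mulE sharp_mul1r.
Qed.

Lemma heis_mulDl : left_distributive heis_mul +%R.
Proof. by move=> u v w; have := heis_mulPl 1 u v w; rewrite !scale1r. Qed.
Lemma heis_mulDr : right_distributive heis_mul +%R.
Proof. by move=> w u v; have := heis_mulPr 1 u v w; rewrite !scale1r. Qed.

Lemma heis_mulA : associative heis_mul.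
Proof.
have mul0l w : heis_mul 0 w = 0.
  by have := heis_mulPl (-1) 0 0 w; rewrite !scaler0 addr0 scaleN1r addNr.
have mul0r w : heis_mul w 0 = 0.
  by have := heis_mulPr (-1) 0 0 w; rewrite !scaler0 addr0 scaleN1r addNr.
move=> u v w; elim/heis_ind: u => [|u u' IHu IHu'|a x].
- by rewrite !mul0l.
- by rewrite !heis_mulDl IHu IHu'.
elim/heis_ind: v => [|v v' IHv IHv'|b y].
- by rewrite !(mul0l, mul0r).
- by rewrite !heis_mulDl !heis_mulDr heis_mulDl IHv IHv'.
elim/heis_ind: w => [|w w' IHw IHw'|c z].
- by rewrite !mul0r.
- by rewrite !heis_mulDr IHw IHw'.
rewrite !heis_mulE /sharp_mul.
have lr al : linear (heis_mul al) by move=> d u v; apply: heis_mulPr.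
have ll be : linear (heis_mul^~ be) by move=> d u v; apply: heis_mulPl.
rewrite (linear_tsum _ _ (lr _)) (linear_tsum _ _ (ll (c # z))).
under eq_tsum => y1 y2.
  rewrite heis_mulE /sharp_mul.
  under eq_tsum => x1 x2.
    rewrite radjM -[_ # _]/((fun u => (a * u) # (x2 * (y2 * z))) _).
    rewrite linear_tsum; last by move=> d u v; rewrite mulPr sharpPl.
    over.
  rewrite (@tsum_comulA _ _ _ (fun x1 x1' x2 =>
     (a * (radj x1 b * radj x1' (radj y1 c))) # (x2 * (y2 * z)))); first last.
  - by move=> *; move=> d u v; rewrite mulPl sharpPr.
  - by move=> *; move=> d u v; rewrite radjPl !mulPr sharpPl.
  - by move=> *; move=> d u v; rewrite radjPl mulPl mulPr sharpPl.
  over.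
rewrite exchange_tsum; apply: eq_tsum => x1 x2.
rewrite heis_mulE /sharp_mul (tsum_comulM _ _ (sharp_mul_body_bilinear _ _ _)).
rewrite exchange_tsum; apply: eq_tsum => y1 y2; apply: eq_tsum => x2' x3.
by rewrite radj_mul !mulrA.
Qed.

Lemma heis_one_neq0 : (1 # 1 : heis) != 0.
Proof.
pose e (a : Hp) (x : Hm) : k^o := (counit a : k) * (counit x : k).
have be : kbilinear e.
  have cP (H : gradedConnectedHopf k) (c : k) (u v : H) :
      (counit (c *: u + v) : k) = c * counit u + counit v := linearP _ _ _ _.
  split=> z c u v; rewrite /e cP.
    by rewrite mulrDl -mulrA.
  by rewrite mulrDr mulrCA.
apply/eqP => /(congr1 (tsum e)); rewrite (tsum_tens be) /e !rmorph1 mulr1.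
have := tsum_linear be (-1) 0 0.
rewrite !scaler0 addr0 scaleN1r addNr => -> /eqP.
by rewrite (negPf (oner_neq0 k)).
Qed.

HB.instance Definition _ := GRing.Zmodule_isNzRing.Build heis
  heis_mulA heis_mul1 heis_mulr1 heis_mulDl heis_mulDr heis_one_neq0.

Lemma heis_scalerAl (c : k) (u v : heis) : c *: (u * v) = (c *: u) * v.
Proof.
have mul0l : heis_mul 0 v = 0 by exact: mul0r.
by have := heis_mulPl c u 0 v; rewrite mul0l !addr0.
Qed.
HB.instance Definition _ := GRing.Lmodule_isLalgebra.Build k heis heis_scalerAl.

Lemma heis_scalerAr (c : k) (u v : heis) : c *: (u * v) = u * (c *: v).
Proof.
have mul0r' : heis_mul u 0 = 0 by exact: mulr0.
by have := heis_mulPr c v 0 u; rewrite mul0r' !addr0.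
Qed.
HB.instance Definition _ := GRing.Lalgebra_isAlgebra.Build k heis heis_scalerAr.

Lemma sharpM a x b y : (a # x) * (b # y) =
  \tsum_(x1, x2 <- comul x) (a * radj x1 b) # (x2 * y).
Proof. exact: heis_mulE. Qed.

Definition nat_act (al : heis) (b : Hp) : Hp := \tsum_(a, x <- al) a * radj x b.

Let bil_act b : kbilinear (fun (a : Hp) x => a * radj x b).
Proof. by split=> z c u v; rewrite ?radjPl ?mulPl ?mulPr. Qed.

Lemma nat_actE a x b : nat_act (a # x) b = a * radj x b.
Proof. exact: tsum_tens. Qed.

Lemma nat_actPl b : linear (nat_act^~ b).
Proof. exact: tsum_linear. Qed.

Lemma nat_actPr al : linear (nat_act al).
Proof.
move=> c u v; rewrite /nat_act -tsumP; apply: eq_tsum => a x.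
by rewrite radjPr mulPr.
Qed.

Lemma nat_act1 b : nat_act 1 b = b.
Proof. by rewrite nat_actE radj_one mul1r. Qed.

Lemma nat_actDl al be b : nat_act (al + be) b = nat_act al b + nat_act be b.
Proof. by have := nat_actPl b 1 al be; rewrite !scale1r. Qed.

Lemma nat_actDr al b c : nat_act al (b + c) = nat_act al b + nat_act al c.
Proof. by have := nat_actPr al 1 b c; rewrite !scale1r. Qed.

Lemma nat_act0l b : nat_act 0 b = 0.
Proof. by apply: (addIr (nat_act 0 b)); rewrite -nat_actDl !add0r. Qed.

Lemma nat_act0r al : nat_act al 0 = 0.
Proof. by apply: (addIr (nat_act al 0)); rewrite -nat_actDr !add0r. Qed.

Lemma nat_actA al be b : nat_act al (nat_act be b) = nat_act (al * be) b.
Proof.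
elim/heis_ind: al => [|u u' IHu IHu'|a x].
- by rewrite mul0r !nat_act0l.
- by rewrite mulrDl !nat_actDl IHu IHu'.
elim/heis_ind: be => [|v v' IHv IHv'|c y].
- by rewrite mulr0 nat_act0l nat_act0r.
- by rewrite mulrDr !nat_actDl nat_actDr IHv IHv'.
rewrite sharpM !nat_actE (linear_tsum _ _ (nat_actPl b)) radjM.
rewrite (linear_tsum _ _ (fun d u v => mulPr d u v a)).
by apply: eq_tsum => x1 x2; rewrite nat_actE radj_mul mulrA.
Qed.

Definition Fock : Type := Hp.
HB.instance Definition _ := GRing.Zmodule.on Fock.
HB.instance Definition _ := GRing.Zmodule_isLmodule.Build heis Fock
  nat_actA nat_act1 nat_actDr (fun b al be => nat_actDl al be b).

End Heisenberg.

Notation "a # x" := (sharp a x) (at level 40, left associativity) : ring_scope.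

Section InvariantSubalgebra.
Variables (k : comNzRingType) (D : dualPair k).

Record invariantSubalgebra := InvariantSubalgebra {
  subalg_mem :> {pred Hp D};
  subalg_mem_closed : subalg_closed subalg_mem;
  subalg_mem_radj : forall x a, a \in subalg_mem -> radj x a \in subalg_mem
}.

Variable X : invariantSubalgebra.

Definition Xsharp_mem : {pred heis D} := fun al =>
  `[< kspan (fun be => exists a x, a \in X /\ be = a # x) al >].

Lemma Xsharp_memP al :
  reflect (exists2 s : seq (Hp D * Hm D), (forall p, p \in s -> p.1 \in X) &
             al = \sum_(p <- s) p.1 # p.2) (al \in Xsharp_mem).
Proof.
have [_ Xlin _] := subalg_mem_closed X.
have XZ c a : a \in X -> c *: a \in X.
  move=> aX; have /(_ (-1) a a aX aX) := Xlin; rewrite scaleN1r addNr => X0.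
  by have := Xlin c a 0 aX X0; rewrite addr0.
apply: (iffP (asboolP _)) => [[s sX ->]|[s sX ->]].
  elim: s sX => [|[c be] s IHs] sX; first by exists [::]; rewrite ?big_nil.
  have [|t tX Et] := IHs; first by move=> p ps; apply: sX; rewrite inE ps orbT.
  have [a [x [aX /= ->]]] := sX (c, be) (mem_head _ _).
  exists ((c *: a, x) :: t); last first.
    rewrite !big_cons Et /=; congr (_ + _).
    by have [tl _] := tens_bilinear (Hp D) (Hm D);
      rewrite /sharp (scalable_linear (tl _)).
  by move=> p; rewrite inE => /orP[/eqP->|/tX //]; apply: XZ.
exists [seq (1, p.1 # p.2) | p <- s].
  by move=> _ /mapP[p ps ->]; exists p.1, p.2; split; first exact: sX.
by rewrite big_map; apply: eq_bigr => p _; rewrite scale1r.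
Qed.

Lemma Xsharp_mem_sharp a x : a \in X -> a # x \in Xsharp_mem.
Proof.
move=> aX; apply/Xsharp_memP; exists [:: (a, x)]; last by rewrite big_seq1.
by move=> p; rewrite inE => /eqP ->.
Qed.

Lemma Xsharp_memD al be : al \in Xsharp_mem -> be \in Xsharp_mem ->
  al + be \in Xsharp_mem.
Proof.
move=> /Xsharp_memP[s sX ->] /Xsharp_memP[t tX ->]; apply/Xsharp_memP.
exists (s ++ t); last by rewrite big_cat.
by move=> p; rewrite mem_cat => /orP[/sX|/tX].
Qed.

Lemma Xsharp_mem0 : 0 \in Xsharp_mem.
Proof. by apply/Xsharp_memP; exists [::]; rewrite ?big_nil. Qed.

Lemma Xsharp_mem_sum (I : eqType) (r : seq I) (F : I -> heis D) :
  (forall i, i \in r -> F i \in Xsharp_mem) -> \sum_(i <- r) F i \in Xsharp_mem.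
Proof.
move=> FX; rewrite big_seq; elim/big_ind: _ => //; first exact: Xsharp_mem0.
exact: Xsharp_memD.
Qed.

Lemma subalg_memM a b : a \in X -> b \in X -> a * b \in X.
Proof. by have [_ _ XM] := subalg_mem_closed X; apply: XM. Qed.

Lemma Xsharp_memM al be : al \in Xsharp_mem -> be \in Xsharp_mem ->
  al * be \in Xsharp_mem.
Proof.
move=> /Xsharp_memP[s sX ->] /Xsharp_memP[t tX ->].
rewrite mulr_suml; apply: Xsharp_mem_sum => p ps.
rewrite mulr_sumr; apply: Xsharp_mem_sum => q qt.
rewrite sharpM; apply: Xsharp_mem_sum => r _; apply: Xsharp_mem_sharp.
by apply: subalg_memM; [apply: sX|apply/subalg_mem_radj/tX].
Qed.

Lemma Xsharp_subalg_closed : subalg_closed Xsharp_mem.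
Proof.
have XZ c al : al \in Xsharp_mem -> c *: al \in Xsharp_mem.
  move=> /asboolP[s sX ->]; apply/asboolP; exists [seq (c * p.1, p.2) | p <- s].
    by move=> _ /mapP[p ps ->] /=; apply: sX.
  by rewrite big_map scaler_sumr; apply: eq_bigr => p _; rewrite scalerA.
split=> [|c u v uX vX|]; last by move=> u v; apply: Xsharp_memM.
  by apply: Xsharp_mem_sharp; have [] := subalg_mem_closed X.
by apply: Xsharp_memD => //; apply: XZ.
Qed.

HB.instance Definition _ := GRing.isSubalgClosed.Build k (heis D) Xsharp_mem
  (GRing.subalg_closed_semi Xsharp_subalg_closed).

Record Xsharp : Type :=
  MkXsharp { Xsharp_val :> heis D; _ : Xsharp_val \in Xsharp_mem }.
HB.instance Definition _ := [isSub of Xsharp for Xsharp_val].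
HB.instance Definition _ := [Choice of Xsharp by <:].
HB.instance Definition _ := [SubChoice_isSubAlgebra of Xsharp by <:].

HB.instance Definition _ := GRing.isSubmodClosed.Build k (Hp D) (subalg_mem X)
  (GRing.submod_closed_semi (GRing.subalg_closedZ (subalg_mem_closed X))).

Record Xmod : Type := MkXmod { Xmod_val :> Hp D; Xmod_valP : Xmod_val \in X }.
HB.instance Definition _ := [isSub of Xmod for Xmod_val].
HB.instance Definition _ := [Choice of Xmod by <:].
HB.instance Definition _ := [SubChoice_isSubZmodule of Xmod by <:].

Lemma nat_act_mem al a : al \in Xsharp_mem -> a \in X -> nat_act al a \in X.
Proof.
move=> /Xsharp_memP[s sX ->] aX.
rewrite (linear_sum_of _ _ (nat_actPl a)).
rewrite big_seq; apply: rpred_sum => p ps; rewrite nat_actE subalg_memM ?sX //.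
exact: subalg_mem_radj.
Qed.

Definition Xmod_scale (al : Xsharp) (a : Xmod) : Xmod :=
  MkXmod (nat_act_mem (valP al) (Xmod_valP a)).

Lemma Xmod_scaleA al be a :
  Xmod_scale al (Xmod_scale be a) = Xmod_scale (al * be) a.
Proof. by apply: val_inj; rewrite /= nat_actA. Qed.
Lemma Xmod_scale1 : left_id 1 Xmod_scale.
Proof. by move=> a; apply: val_inj; rewrite /= nat_act1. Qed.
Lemma Xmod_scaleDr : right_distributive Xmod_scale +%R.
Proof. by move=> al a b; apply: val_inj; rewrite /= nat_actDr. Qed.
Lemma Xmod_scaleDl a : {morph Xmod_scale^~ a : al be / al + be}.
Proof. by move=> al be; apply: val_inj; rewrite /= nat_actDl. Qed.

HB.instance Definition _ := GRing.Zmodule_isLmodule.Build Xsharp Xmod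
  Xmod_scaleA Xmod_scale1 Xmod_scaleDr Xmod_scaleDl.

Lemma one_sharp_mem (x : Hm D) : 1 # x \in Xsharp_mem.
Proof. by apply: Xsharp_mem_sharp; have [] := subalg_mem_closed X. Qed.

Definition Hm_Xsharp (x : Hm D) : Xsharp := MkXsharp (one_sharp_mem x).

Lemma Hm_Xsharp_is_zmod_morphism : zmod_morphism Hm_Xsharp.
Proof.
move=> x y; apply: val_inj => /=; have := sharpPr (-1) 1 y x.
by rewrite !scaleN1r addrC => ->; rewrite addrC.
Qed.

Lemma Hm_Xsharp_is_monoid_morphism : monoid_morphism Hm_Xsharp.
Proof.
split=> [|x y]; apply: val_inj => //=.
rewrite sharpM -(@tsum_counitl _ _ _ (fun z => 1 # (z * y))) => [|c u v].
  apply: eq_tsum => x1 x2; rewrite radj1 mul1r.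
  by have [tl _] := tens_bilinear (Hp D) (Hm D);
    rewrite /sharp (scalable_linear (tl _)).
by rewrite mulPl sharpPr.
Qed.

HB.instance Definition _ :=
  GRing.isZmodMorphism.Build (Hm D) Xsharp Hm_Xsharp Hm_Xsharp_is_zmod_morphism.
HB.instance Definition _ :=
  GRing.isMonoidMorphism.Build (Hm D) Xsharp Hm_Xsharp Hm_Xsharp_is_monoid_morphism.

End InvariantSubalgebra.

Section Induced.
Variables (B A : nzRingType) (iota : {rmorphism B -> A}) (N : lmodType B).

Definition rmul_along (b : B) : A^o -> A^o := fun a => a * iota b.

Lemma rmul_along_linear b : linear (rmul_along b).
Proof. by move=> c u v; rewrite /rmul_along mulrDl -mulrA. Qed.
HB.instance Definition _ b :=
  GRing.isLinear.Build A A^o A^o *:%R (rmul_along b) (rmul_along_linear b).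

Definition induced : Type :=
  tensor (fun b : B => rmul_along b : {linear A^o -> A^o}) (fun (b : B) (n : N) => b *: n).
HB.instance Definition _ := GRing.Lmodule.on induced.
End Induced.

Definition kminus (k : comNzRingType) (H : gradedConnectedHopf k) : Type := k.

Section Trivial.
Variables (k : comNzRingType) (H : gradedConnectedHopf k).
Local Notation kminus := (kminus H).

HB.instance Definition _ := GRing.Zmodule.on kminus.

(* H_n acts by zero for n > 0 and H_0 = k 1 by multiplication, so the action
   factors through the counit. *)
Definition kminus_act (x : H) (c : kminus) : kminus := (counit x : k) * c.

Lemma kminus_actA x y c : kminus_act x (kminus_act y c) = kminus_act (x * y) c.
Proof. by rewrite /kminus_act rmorphM mulrA. Qed.
Lemma kminus_act1 : left_id 1 kminus_act.
Proof. by move=> c; rewrite /kminus_act rmorph1 mul1r. Qed.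
Lemma kminus_actDr : right_distributive kminus_act +%R.
Proof. by move=> x c d; rewrite /kminus_act mulrDr. Qed.
Lemma kminus_actDl c : {morph kminus_act^~ c : x y / x + y}.
Proof. by move=> x y; rewrite /kminus_act raddfD mulrDl. Qed.

HB.instance Definition _ := GRing.Zmodule_isLmodule.Build H kminus
  kminus_actA kminus_act1 kminus_actDr kminus_actDl.
End Trivial.

Lemma kminus_deg (k : comNzRingType) (H : gradedConnectedHopf k) n (x : H)
  (c : kminus H) : (0 < n)%N -> x \in deg H n -> x *: c = 0.
Proof.
by move=> n0 xn; rewrite /GRing.scale /= /kminus_act (deg_counit n0 xn) mul0r.
Qed.

Lemma kminus_scalar (k : comNzRingType) (H : gradedConnectedHopf k) (d : k)
  (c : kminus H) : (d%:A : H) *: c = (d * c : k).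
Proof.
rewrite /GRing.scale /= /kminus_act linearZ /= rmorph1.
by rewrite /GRing.scale /= mulr1.
Qed.

Definition lmod_iso (A : nzRingType) (V W : lmodType A) : Prop :=
  exists f : {linear V -> W}, bijective f.

(* As the logic is classical here, a boolean predicate is an arbitrary subset. *)
Definition irreducible_mod (A : nzRingType) (V : lmodType A) : Prop :=
  (exists v : V, v != 0) /\
  forall W : {pred V}, submod_closed W ->
    (forall v, v \in W -> v = 0) \/ (forall v, v \in W).

Definition faithful_mod (A : nzRingType) (V : lmodType A) : Prop :=
  forall a : A, (forall v : V, a *: v = 0) -> a = 0.

Definition generates (A : nzRingType) (V : lmodType A) (v : V) : Prop :=
  forall w : V, exists a : A, w = a *: v.

Section Statements.
Variable k : comNzRingType.

Definition ring_is_field : Prop := forall c : k, c != 0 -> exists d : k, d * c = 1.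

(* idealr_closed of ring_quotient only covers proper ideals. *)
Definition is_ideal (I : {pred k}) : Prop := submod_closed (I : {pred k^o}).

Definition ideal_mul (V : lmodType k) (I : {pred k}) (U : {pred V}) (v : V) : Prop :=
  exists2 s : seq (k * V), (forall p, p \in s -> p.1 \in I /\ p.2 \in U) &
    v = \sum_(p <- s) p.1 *: p.2.

Variables (D : dualPair k) (X : invariantSubalgebra D).

(* X^+ meets each I H^+ in I X^+. This holds when k is a field, when X^+ = H^+
   and when X^+ is a direct summand of H^+, and it is necessary for every
   submodule of X^+ to be of the form I X^+, since X^+ ∩ I H^+ is a submodule
   and J X^+ = X^+ ∩ I H^+ forces J = I. It can fail: take k = F_2[t] and
   H^+ = H^- = k[x]/(x^2) with x primitive of degree 1, X^+ = k + t k x, I = t k. *)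
Definition ideal_pure : Prop :=
  forall I : {pred k}, is_ideal I -> forall a : Hp D,
    a \in X -> ideal_mul I predT a -> ideal_mul I (subalg_mem X) a.

(* k v is isomorphic to k as a k-module, for the k-module structure that V gets
   from the k-algebra structure of X^+ # H^-. *)
Definition free_line (V : lmodType (Xsharp X)) (v : V) : Prop :=
  exists phi : k -> V,
    [/\ forall c d e : k, phi (c * d + e) = (c%:A : Xsharp X) *: phi d + phi e,
        injective phi &
        forall w, (exists d, w = phi d) <-> (exists c : k, w = (c%:A : Xsharp X) *: v)].

Definition lowest_weight_vacuum (V : lmodType (Xsharp X)) (v : V) : Prop :=
  free_line v /\
  forall n (x : Hm D), (0 < n)%N -> x \in deg (Hm D) n -> Hm_Xsharp X x *: v = 0.

End Statements.

Arguments ring_is_field k : clear implicits.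

(* Main.v *)
Require Import Defs.
From HB Require Import structures.
From mathcomp Require Import all_boot all_algebra.
From mathcomp Require Import boolp.

Import GRing.Theory.
Local Open Scope ring_scope.

Set Implicit Arguments.
Unset Strict Implicit.
Unset Printing Implicit Defensive.

(* For x of degree n and a with no component above degree n, {}^R x^*(a) is the
   scalar <x, a>.  So if K is a subset of H^+ stable under the left-regular
   action and a is in K, acting by H^-_n and descending from the top degree n of
   a recovers the components of a from the scalars in K.  For K a submodule this
   gives (1); for K the kernel of a |-> (a # 1) v, with v a vacuum vector, it
   gives (3).  In (2) the same map has the retraction al (x) c |-> c (al 1).
   For faithfulness, sort an operator killing H^+ by degree on the H^- side:
   its lowest component is detected by elements of H^+ of the same degree. *)

(** * Dual bases and homogeneous components *)

(** By uniqueness of coordinates, the coordinate functionals of a basis of [U] are linear on [U], so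
    perfectness represents each of them by an element of [T]. *)
Lemma dual_bases (k : comNzRingType) (V W : lmodType k)
    (U : {pred V}) (T : {pred W}) (beta : V -> W -> k) :
  submod_closed U -> finite_free U -> perfect_on U T beta ->
  exists d (b : 'I_d -> V) (w : 'I_d -> W),
    [/\ forall i, b i \in U, forall i, w i \in T &
        forall u, u \in U -> u = \sum_i beta u (w i) *: b i].
Proof.
move=> [_ Ulin] [d [b [bU bfree]]] [_ perf].
have coordP u : exists c : {ffun 'I_d -> k},
    u \in U -> u = \sum_i c i *: b i.
  (* Outside [U] the coordinates get the default value 0, so that [co] is a total function. *)
  have [uU|_] := boolP (u \in U); last by exists [ffun=> 0].
  by have [c [def_u _]] := bfree u uU; exists c.
pose co u := sval (cid (coordP u)).
have coE u : u \in U -> u = \sum_i co u i *: b i := svalP (cid (coordP u)).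
have co_lin i : linear_on U (fun u => co u i).
  move=> c u v uU vU; have uvU : c *: u + v \in U by apply: Ulin.
  have [c0 [_ uniq_c]] := bfree _ uvU.
  suff <- : [ffun j => c * co u j + co v j] = co (c *: u + v) by rewrite ffunE.
  rewrite -(uniq_c (co (c *: u + v)) (coE _ uvU)); apply/esym/uniq_c.
  rewrite {1}(coE u uU) {1}(coE v vU) scaler_sumr -big_split.
  by apply: eq_bigr => j _; rewrite ffunE scalerDl scalerA.
have wP i : exists w, w \in T /\ forall u, u \in U -> beta u w = co u i.
  by have [w [wP _]] := perf _ (co_lin i); exists w.
exists d, b, (fun i => sval (cid (wP i))); split=> // [i|u uU].
  by have [] := svalP (cid (wP i)).
rewrite {1}(coE u uU); apply: eq_bigr => i _; congr (_ *: _).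
by have [_ ->] := svalP (cid (wP i)).
Qed.

Section GradedHopf.
Variables (k : comNzRingType) (H : gradedConnectedHopf k).

Lemma deg_mem0 n : 0 \in deg H n.
Proof. by case: (deg_submod H n). Qed.

(** The components are continued by 0 past the last degree. The bound [M] stays free so that
    decompositions of different lengths can be brought to a common one. *)
Lemma deg_decomp (a : H) : exists N (f : nat -> H),
  (forall n, f n \in deg H n) /\
  forall M, (N <= M)%N -> a = \sum_(n < M) f n.
Proof.
have [N [f [fdeg ->]]] := (deg_direct H).1 a.
exists N, (fun n => if insub n is Some i then f i else 0); split=> [n|M leNM].
  by case: insubP => [i _ <-|_]; [apply: fdeg | apply: deg_mem0].
rewrite -[RHS](big_mkord xpredT (fun n => if insub n is Some i then f i else 0)).
rewrite (@big_cat_nat _ _ _ N) //= [X in _ + X]big1_seq ?addr0; last first.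
  move=> n; rewrite mem_index_iota => /andP[_ /andP[leNn _]].
  by rewrite insubN // -leqNgt.
by rewrite big_mkord; apply: eq_bigr => i _; rewrite valK.
Qed.

End GradedHopf.

(** * Products of an ideal with a subset of a module *)

Section IdealMul.
Variables (k : comNzRingType) (V : lmodType k).

Lemma ideal_mulD (I : {pred k}) (U : {pred V}) u v :
  ideal_mul I U u -> ideal_mul I U v -> ideal_mul I U (u + v).
Proof.
move=> [s sI ->] [t tI ->]; exists (s ++ t); last by rewrite big_cat.
by move=> p; rewrite mem_cat => /orP[/sI|/tI].
Qed.

Lemma ideal_mul0 (I : {pred k}) (U : {pred V}) : ideal_mul I U 0.
Proof. by exists [::]; rewrite ?big_nil. Qed.

Lemma ideal_mulZ (I : {pred k}) (U : {pred V}) c v :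
  c \in I -> v \in U -> ideal_mul I U (c *: v).
Proof.
move=> cI vU; exists [:: (c, v)]; last by rewrite big_seq1.
by move=> p; rewrite inE => /eqP->.
Qed.

Lemma ideal_mul_sum (I : {pred k}) (U : {pred V}) J (r : seq J) (P : pred J) F :
  (forall j, P j -> ideal_mul I U (F j)) -> ideal_mul I U (\sum_(j <- r | P j) F j).
Proof.
move=> FI; elim/big_ind: _ => //; first exact: ideal_mul0.
exact: ideal_mulD.
Qed.

Lemma ideal_mul_linear (W : lmodType k) (I : {pred k}) (U : {pred V})
    (T : {pred W}) (g : V -> W) v :
  linear g -> (forall u, u \in U -> g u \in T) ->
  ideal_mul I U v -> ideal_mul I T (g v).
Proof.
move=> lg gUT [s sI ->]; exists [seq (p.1, g p.2) | p <- s].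
  by move=> _ /mapP[p /sI[pI pU] ->]; split=> //; apply: gUT.
rewrite (linear_sum_of _ _ lg) big_map; apply: eq_bigr => p _.
by rewrite (scalable_linear lg).
Qed.

End IdealMul.

(** * The left-regular action on homogeneous elements *)

Section LeftRegularDegree.
Variables (k : comNzRingType) (D : dualPair k).

(** Pair both sides with [y]. A component of [y] of degree j > 0 contributes nothing: its product
    with [x] has degree j + n > m, hence is orthogonal to [a], and its counit is 0. The component of
    degree 0 is a scalar, namely its own counit. *)
Lemma radj_top m n (x : Hm D) (a : Hp D) :
  (m <= n)%N -> x \in deg (Hm D) n -> a \in deg (Hp D) m ->
  radj x a = pair D x a *: 1.
Proof.
move=> lemn xn am; apply: pair_inj => y.
rewrite pair_radj (linearZr_LR (pair D)) /= pair1r.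
have [N [f [fdeg /(_ N (leqnn N))->]]] := deg_decomp y.
rewrite mulr_suml linear_sum mulr_sumr linear_sumlz; apply: eq_bigr => j _.
case: (posnP j) => [j0|j_gt0].
  have := fdeg j; rewrite j0 => /deg0E[c ->].
  rewrite linearZ /= rmorph1 -scalerAl mul1r (linearZl_LR (pair D)) /=.
  by rewrite /GRing.scale /= mulr1 mulrC.
transitivity (0 : k); last first.
  rewrite -(mulr0 (pair D x a)); congr (_ * _).
  exact/esym/(deg_counit j_gt0 (fdeg j)).
apply: pair_orth (degM (fdeg j) xn) am.
by rewrite gtn_eqF // -add1n leq_add.
Qed.

Lemma radj_lt m n (x : Hm D) (a : Hp D) :
  (m < n)%N -> x \in deg (Hm D) n -> a \in deg (Hp D) m -> radj x a = 0.
Proof.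
move=> ltmn xn am; rewrite (radj_top (ltnW ltmn) xn am).
by rewrite (pair_orth _ xn am) ?scale0r // gtn_eqF.
Qed.

(** The coordinates of [a] in a basis of its degree are the pairings of [a] with the dual basis. *)
Lemma ideal_mul_homogeneous (I : {pred k}) n (a : Hp D) :
  a \in deg (Hp D) n ->
  (forall x, x \in deg (Hm D) n -> pair D x a \in I) ->
  ideal_mul I predT a.
Proof.
move=> an aI; have [perfl perfr] := pair_perfect D n.
(* The pairing is flipped, since the element to be expanded lies in [Hp D], its second argument. *)
have [d [b [w [_ wn def_a]]]] := dual_bases (beta := fun a x => pair D x a)
  (deg_submod _ n) (deg_free _ n) (conj perfr perfl).
by rewrite (def_a a an); apply: ideal_mul_sum => i _; apply: ideal_mulZ; rewrite ?aI.
Qed.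

(* Applied with I = 0 as well, where it says that a nonzero K meets k 1. *)
Lemma radj_closed_sub_ideal (I : {pred k}) (K : Hp D -> Prop) :
  (forall x a, K a -> K (radj x a)) ->
  (forall c h, ideal_mul I predT h -> K (c *: 1 + h) -> c \in I) ->
  forall a, K a -> ideal_mul I predT a.
Proof.
move=> Kradj KI a Ka.
have [N [f [fdeg /(_ N (leqnn N)) def_a]]] := deg_decomp a.
(* Descent from the top degree: [m] counts how many of the highest components are already
   treated. *)
suff fI m : forall i : 'I_N, (N <= i + m)%N -> ideal_mul I predT (f i).
  by rewrite def_a; apply: ideal_mul_sum => i _; apply: (fI N); rewrite leq_addl.
elim: m => [|m IHm] i leNim; first by move: leNim; rewrite addn0 leqNgt ltn_ord.
apply: (ideal_mul_homogeneous (fdeg i)) => x xi.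
(* Acting by [x] of degree [i] kills the components below [i] and turns the one in degree [i] into
   its pairing with [x]. Those above [i] stay in I H^+ by induction. *)
apply: (KI _ (\sum_(j < N | j != i) radj x (f j))).
  apply: ideal_mul_sum => j nji.
  have [ltji|ltij|eqji] := ltngtP j i; last by case/eqP: nji; apply: val_inj.
    by rewrite (radj_lt ltji xi (fdeg j)); apply: ideal_mul0.
  apply: (@ideal_mul_linear _ _ _ _ predT) => [c u v||]; first exact: radjPr.
    by [].
  by apply: IHm; rewrite (leq_trans leNim) // addnS -addSn leq_add2r.
suff <- : radj x a = pair D x (f i) *: 1 + \sum_(j < N | j != i) radj x (f j).
  exact: Kradj.
rewrite def_a (linear_sum_of _ _ (fun c => radjPr c x)) (bigD1 i) //=.
by rewrite (radj_top (leqnn i) xi (fdeg i)).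
Qed.

End LeftRegularDegree.

(** * Module isomorphisms, vacuum vectors and the induced module *)

Lemma lmod_iso_bij (A : nzRingType) (V W : lmodType A) (g : V -> W) :
  linear g -> injective g -> (forall w, exists v, w = g v) -> lmod_iso V W.
Proof.
move=> lg ginj gsurj; pose l := GRing.isLinear.Build _ _ _ _ g lg.
pose h : {linear V -> W} := HB.pack g l.
exists h; exists (fun w => sval (cid (gsurj w))) => [v|w].
  by apply: ginj; rewrite -(svalP (cid (gsurj (h v)))).
by rewrite [RHS](svalP (cid (gsurj w))).
Qed.

Lemma lmod_iso_sym (A : nzRingType) (V W : lmodType A) :
  lmod_iso V W -> lmod_iso W V.
Proof.
move=> [f [g fK gK]]; apply: (@lmod_iso_bij _ _ _ g).
- by move=> c u v; apply: (can_inj fK); rewrite linearP !gK.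
- exact: can_inj gK.
- by move=> v; exists (f v); rewrite fK.
Qed.

Section Vacuum.
Variables (k : comNzRingType) (D : dualPair k) (X : invariantSubalgebra D).

Definition Xmod_sharp (a : Xmod X) : Xsharp X :=
  MkXsharp (Xsharp_mem_sharp 1 (Xmod_valP a)).

Lemma subalg_mem1 : 1 \in X.
Proof. by case: (subalg_mem_closed X). Qed.

Definition Xmod1 : Xmod X := MkXmod subalg_mem1.

Lemma sharp_factor (a : Hp D) (x : Hm D) : a # x = (a # 1) * (1 # x) :> heis D.
Proof.
rewrite sharpM comul1 tsum_tens ?radj_one ?mulr1 ?mul1r //.
exact: sharp_mul_body_bilinear.
Qed.

(** Writing a # x as (a # 1)(1 # x) lets [x] act first, which is the order suited to a vacuum
    vector. *)
Lemma Xsharp_ind (Q : Xsharp X -> Prop) :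
  Q 0 -> (forall al be, Q al -> Q be -> Q (al + be)) ->
  (forall a x, Q (Xmod_sharp a * Hm_Xsharp X x)) -> forall al, Q al.
Proof.
move=> Q0 QD Qax al; have [s sX def_al] := Xsharp_memP _ _ (valP al).
elim: s al sX def_al => [|[a x] s IHs] al sX.
  by rewrite big_nil => al0; rewrite (_ : al = 0) //; apply: val_inj.
rewrite big_cons => def_al.
have aX : a \in X by apply: (sX (a, x)); rewrite mem_head.
have sX' p : p \in s -> p.1 \in X by move=> ps; apply: sX; rewrite inE ps orbT.
have sumX : \sum_(p <- s) p.1 # p.2 \in Xsharp_mem X by apply/Xsharp_memP; exists s.
have -> : al = Xmod_sharp (MkXmod aX) * Hm_Xsharp X x + MkXsharp sumX.
  by apply: val_inj; rewrite /= -sharp_factor.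
by apply: QD (Qax _ _) (IHs _ sX' _).
Qed.

Lemma Xmod_sharpD (a b : Xmod X) : Xmod_sharp (a + b) = Xmod_sharp a + Xmod_sharp b.
Proof.
by apply: val_inj => /=; have := sharpPl 1 (val a) (val b) 1; rewrite !scale1r.
Qed.

Lemma Xmod_sharp0 : Xmod_sharp 0 = 0.
Proof. by apply: (addIr (Xmod_sharp 0)); rewrite -Xmod_sharpD !add0r. Qed.

Lemma Xmod_sharp_act1 (a : Xmod X) : Xmod_sharp a *: Xmod1 = a.
Proof. by apply: val_inj; rewrite /= nat_actE radj_one mulr1. Qed.

Lemma Hm_Xsharp_act_val (x : Hm D) (a : Xmod X) :
  Xmod_val (Hm_Xsharp X x *: a) = radj x (Xmod_val a).
Proof. by rewrite /= nat_actE mul1r. Qed.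

Lemma scalar_act_val (c : k) (a : Xmod X) :
  Xmod_val ((c%:A : Xsharp X) *: a) = c *: Xmod_val a.
Proof. by rewrite /= (scalable_linear (nat_actPl _)) nat_act1. Qed.

Lemma Hm_Xsharp_scalar (c : k) : Hm_Xsharp X c%:A = c%:A.
Proof.
apply: val_inj => /=; have [_ tr] := tens_bilinear (Hp D) (Hm D).
by rewrite /sharp (scalable_linear (tr _)).
Qed.

Lemma Hm_Xsharp_act1 (x : Hm D) :
  Hm_Xsharp X x *: Xmod1 = ((counit x : k)%:A : Xsharp X) *: Xmod1.
Proof. by apply: val_inj; rewrite [LHS]Hm_Xsharp_act_val [RHS]scalar_act_val radj1. Qed.

Section Orbit.
Variables (V : lmodType (Xsharp X)) (v : V).
Hypothesis vac : forall x : Hm D,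
  Hm_Xsharp X x *: v = ((counit x : k)%:A : Xsharp X) *: v.

(** On [v] as on 1, the factor [x] of a # x acts as the scalar [counit x], leaving a multiple of a #
    1. Phrased through [vac], this serves both the vacuum vectors of (3) and the generator of the
    induced module in (2). *)
Lemma vacuum_act (al : Xsharp X) : al *: v = Xmod_sharp (al *: Xmod1) *: v.
Proof.
elim/Xsharp_ind: al => [|al be IHal IHbe|a x].
- by rewrite !scale0r Xmod_sharp0 scale0r.
- by rewrite !scalerDl Xmod_sharpD scalerDl IHal IHbe.
rewrite -!scalerA vac Hm_Xsharp_act1 !scalerA; congr (_ *: _).
apply: val_inj; rewrite /= -scalerAr mulr1.
rewrite (scalable_linear (nat_actPl _)) nat_actE radj_one mulr1.
by have [tl _] := tens_bilinear (Hp D) (Hm D); rewrite /sharp (scalable_linear (tl _)).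
Qed.

Lemma vacuum_map_linear : linear (fun a : Xmod X => Xmod_sharp a *: v).
Proof.
move=> al a b; rewrite Xmod_sharpD scalerDl scalerA (vacuum_act (al * _)).
by rewrite -scalerA Xmod_sharp_act1.
Qed.

End Orbit.

(** Components of [x] of positive degree kill [v] and have counit 0; the one of degree 0 is a
    scalar. *)
Lemma lowest_weight_vacuum_act (V : lmodType (Xsharp X)) (v : V) :
  lowest_weight_vacuum v -> forall x : Hm D,
  Hm_Xsharp X x *: v = ((counit x : k)%:A : Xsharp X) *: v.
Proof.
move=> [_ vac0] x; have [N [f [fdeg /(_ N (leqnn N))->]]] := deg_decomp x.
rewrite raddf_sum scaler_suml linear_sum scaler_suml scaler_suml.
apply: eq_bigr => i _.
suff : Hm_Xsharp X (f i) *: v = ((counit (f i) : k)%:A : Xsharp X) *: v by [].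
case: (posnP i) => [i0|i_gt0]; last first.
  by rewrite (vac0 i) // (deg_counit i_gt0 (fdeg i)) !scale0r.
have := fdeg i; rewrite i0 => /deg0E[c ->].
by rewrite Hm_Xsharp_scalar linearZ /= rmorph1 /GRing.scale /= mulr1.
Qed.

(** [free_line] gives an abstract isomorphism [phi], under which [v] need not correspond to 1. But v
    = phi d0 and phi 1 = c0 v, so c0 d0 = 1 by injectivity; thus d0 is a unit, and c d0 = 0 forces c
    = 0. *)
Lemma free_line_inj (V : lmodType (Xsharp X)) (v : V) (c : k) :
  free_line v -> (c%:A : Xsharp X) *: v = 0 -> c = 0.
Proof.
move=> [phi [philin phiinj phiE]] cv0.
have phi0 : phi 0 = 0.
  by have := philin (-1) 0 0; rewrite mulr0 addr0 !scaleN1r addNr.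
have phiZ a d : phi (a * d) = (a%:A : Xsharp X) *: phi d.
  by have := philin a d 0; rewrite phi0 !addr0.
have [|d0 def_v] := (phiE v).2; first by exists 1; rewrite !scale1r.
have [|c0 phi1] := (phiE (phi 1)).1; first by exists 1.
have c0d0 : c0 * d0 = 1 by apply: phiinj; rewrite phiZ -def_v.
have cd0 : c * d0 = 0 by apply: phiinj; rewrite phiZ -def_v phi0.
by rewrite -[c]mulr1 -c0d0 mulrCA cd0 mulr0.
Qed.

Lemma vacuum_module_iso (V : lmodType (Xsharp X)) (v : V) :
  lowest_weight_vacuum v -> generates v -> lmod_iso V (Xmod X).
Proof.
move=> vac_v gen_v; have act_v := lowest_weight_vacuum_act vac_v.
have g_lin := vacuum_map_linear act_v.
apply/lmod_iso_sym/(lmod_iso_bij g_lin) => [a b /eqP|w]; last first.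
  by have [al ->] := gen_v w; exists (al *: Xmod1); apply: vacuum_act.
rewrite -subr_eq0 -scalerBl => /eqP eq_ab.
(* [K] is the kernel, viewed inside H^+. The descent is run with the zero ideal, for which
   membership in I H^+ means being 0. *)
pose K h := exists2 a : Xmod X, Xmod_val a = h & Xmod_sharp a *: v = 0.
have inj0 : forall h, K h -> ideal_mul (pred1 (0 : k)) predT h.
  apply: radj_closed_sub_ideal.
    move=> x _ [c <- c0]; exists (Hm_Xsharp X x *: c).
      exact: Hm_Xsharp_act_val.
    by have := g_lin (Hm_Xsharp X x) c 0; rewrite Xmod_sharp0 scale0r !addr0 c0 scaler0.
  (* Here h = 0, so c 1 lies in the kernel, that is c v = 0. *)
  move=> c h [s s0 ->] [d def_d d0]; apply/eqP/(free_line_inj vac_v.1).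
  rewrite vacuum_act // -d0; congr (Xmod_sharp _ *: _); apply: val_inj.
  rewrite [LHS]scalar_act_val /= def_d big1_seq ?addr0 // => p /andP[_ /s0[/eqP-> _]].
  exact: scale0r.
suff: val (a - b) = 0 by move=> /eqP; rewrite /= subr_eq0 => /eqP /val_inj.
have [|s s0 ->] := inj0 (val (a - b)).
  exists (a - b) => //; rewrite -eq_ab scalerBl.
  by have := g_lin (-1) b a; rewrite !scaleN1r !(addrC (- _)).
by apply: big1_seq => p /andP[_ /s0[/eqP-> _]]; apply: scale0r.
Qed.

Local Notation N := (kminus (Hm D)).
Local Notation ind := (induced (Hm_Xsharp X) N).

Definition ind_pure (al : Xsharp X) (c : N) : ind :=
  pure_tensor _ _ (al : (Xsharp X)^o) c.

Lemma ind_pure_balanced al (x : Hm D) (c : N) :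
  ind_pure (al * Hm_Xsharp X x) c = ind_pure al (x *: c).
Proof.
have [_ _ bal] := pure_tensor_balanced
  (fun b : Hm D => rmul_along (Hm_Xsharp X) b : {linear (Xsharp X)^o -> (Xsharp X)^o})
  (fun (b : Hm D) (n : N) => b *: n).
exact: bal.
Qed.

Lemma ind_pureZ al be (c : N) : al *: ind_pure be c = ind_pure (al * be) c.
Proof. by rewrite /ind_pure -pure_tensorZ. Qed.

(** The scalar [c] crosses the tensor sign as an element of degree 0 of H^-. Hence the pure tensor
    of 1 and 1 generates the induced module. *)
Lemma ind_pureE al (c : N) :
  ind_pure al c = (al * ((c : k)%:A : Xsharp X)) *: ind_pure 1 (1 : k).
Proof.
rewrite ind_pureZ mulr1 -Hm_Xsharp_scalar ind_pure_balanced.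
by congr ind_pure; rewrite kminus_scalar mulr1.
Qed.

Lemma Xmod_iso_induced : lmod_iso (Xmod X) ind.
Proof.
pose v := ind_pure 1 (1 : k).
have vac x : Hm_Xsharp X x *: v = ((counit x : k)%:A : Xsharp X) *: v.
  have E y : Hm_Xsharp X y *: v = ind_pure 1 (y *: ((1 : k) : N)).
    by rewrite ind_pureZ mulr1 -ind_pure_balanced mul1r.
  rewrite -Hm_Xsharp_scalar !E kminus_scalar.
  by congr ind_pure; rewrite /GRing.scale.
pose f (al : (Xsharp X)^o) (c : N) : Xmod X :=
  (al : Xsharp X) *: (((c : k)%:A : Xsharp X) *: Xmod1).
(* The point is that [b] acts on multiples of 1 in X^+ through the counit, exactly as it does on
   [kminus]. *)
have bf : balanced
  (fun b : Hm D => rmul_along (Hm_Xsharp X) b : {linear (Xsharp X)^o -> (Xsharp X)^o})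
  (fun (b : Hm D) (n : N) => b *: n) f.
  split=> [al be c|al c d|b al c]; rewrite /f.
  - by rewrite scalerDl.
  - by rewrite !scalerDl scalerDr.
  rewrite /= /rmul_along -scalerA; congr (_ *: _); apply: val_inj.
  rewrite [LHS]Hm_Xsharp_act_val scalar_act_val [RHS]scalar_act_val.
  have -> : radj b ((c : k) *: 1) = ((c : k) * counit b) *: 1.
    by rewrite (scalable_linear (fun c => radjPr c b)) /= radj1 scalerA.
  by congr (_ *: _); rewrite mulrC.
have rg a : tensor_lift f (Xmod_sharp a *: v) = a.
  rewrite /v ind_pureZ mulr1 tensor_lift_pure // /f.
  by rewrite !scale1r Xmod_sharp_act1.
apply: (lmod_iso_bij (vacuum_map_linear vac)) => [|w]; first exact: can_inj rg.
suff [al ->] : exists al : Xsharp X, w = al *: v.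
  by exists (al *: Xmod1); apply: vacuum_act.
rewrite (tensorE w); elim: (tensor_repr w) => [|p s [al IHs]].
  by exists 0; rewrite big_nil scale0r.
exists (p.1 * ((p.2 : k)%:A : Xsharp X) + al).
by rewrite big_cons IHs scalerDl -ind_pureE.
Qed.

End Vacuum.

(** * Submodules of X^+ and ideals of k *)

Section Submodules.
Variables (k : comNzRingType) (D : dualPair k) (X : invariantSubalgebra D).

Lemma ideal_mul_submod (I : {pred k}) (W : {pred Xmod X}) :
  (forall a : Xmod X, a \in W <-> ideal_mul I (subalg_mem X) (Xmod_val a)) ->
  submod_closed W.
Proof.
move=> WE; split=> [|al a b /WE aI /WE bI]; apply/WE; first exact: ideal_mul0.
apply: ideal_mulD => //; apply: ideal_mul_linear aI; first exact: nat_actPr.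
by move=> u; apply: nat_act_mem; apply: valP.
Qed.

Section Submodule.
Variable W : {pred Xmod X}.
Hypothesis subW : submod_closed W.

(* The ideal I for which W will be I X^+. *)
Definition submod_scalars : {pred k} :=
  fun c => ((c%:A : Xsharp X) *: Xmod1 X) \in W.

Lemma submod_act al a : a \in W -> al *: a \in W.
Proof. by case: subW => W0 Wlin aW; rewrite -[_ *: a]addr0; apply: Wlin. Qed.

Lemma submod_scalars_ideal : is_ideal submod_scalars.
Proof.
have [W0 Wlin] := subW; split=> [|c d e]; rewrite ?unfold_in.
  by rewrite /submod_scalars !scale0r.
rewrite /submod_scalars => dW eW; rewrite /in_mem /=.
have := Wlin (c%:A) _ _ dW eW.
by rewrite scalerA -scalerAl mul1r -scalerDl scalerA -scalerDl.
Qed.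

(** The scalar [c] is central, so c b is the image of c 1 under b # 1. *)
Lemma submod_scalars_act c b : c \in submod_scalars -> (c%:A : Xsharp X) *: b \in W.
Proof.
move=> cW; rewrite -[b in X in X \in _]Xmod_sharp_act1.
suff -> : (c%:A : Xsharp X) *: (Xmod_sharp b *: Xmod1 X) =
    Xmod_sharp b *: ((c%:A : Xsharp X) *: Xmod1 X) by apply: submod_act.
by rewrite !scalerA -scalerAl -scalerAr mul1r mulr1.
Qed.

Lemma ideal_mul_sub (a : Xmod X) :
  ideal_mul submod_scalars (subalg_mem X) (Xmod_val a) -> a \in W.
Proof.
move=> [s sI def_a]; have [W0 Wlin] := subW.
elim: s a sI def_a => [|[c b] s IHs] a sI; rewrite ?big_nil ?big_cons.
  by move=> a0; rewrite (_ : a = 0) //; apply: val_inj.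
have [cI bX] := sI (c, b) (mem_head _ _).
move=> def_a; pose b' := (c%:A : Xsharp X) *: MkXmod bX.
rewrite -(subrK b' a) addrC -[b']scale1r; apply: Wlin.
  exact: submod_scalars_act.
apply: IHs => [p ps|]; first by apply: sI; rewrite inE ps orbT.
rewrite scale1r; transitivity (Xmod_val a - Xmod_val b') => //.
by rewrite def_a scalar_act_val /= addrC addKr.
Qed.

(** This is the descent for the image of [W] in H^+. The condition on c 1 + h is kept as a
    hypothesis because it is met in two ways: by purity for the ideal of scalars of [W], and
    directly for the zero ideal. *)
Lemma submod_sub_ideal (I : {pred k}) :
  (forall c h, ideal_mul I predT h ->
     (exists2 a, a \in W & Xmod_val a = c *: 1 + h) -> c \in I) ->
  forall a, a \in W -> ideal_mul I predT (Xmod_val a).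
Proof.
move=> WI a aW.
apply: (@radj_closed_sub_ideal _ _ _ (fun h => exists2 a, a \in W & Xmod_val a = h)).
- move=> x _ [b bW <-]; exists (Hm_Xsharp X x *: b); first exact: submod_act.
  exact: Hm_Xsharp_act_val.
- exact: WI.
by exists a.
Qed.

End Submodule.

(** With I the scalars of [W], the inclusion of I X^+ in [W] is formal. Conversely, the descent
    places [W] in I H^+, and purity improves this to I X^+. *)
Lemma submod_idealP (W : {pred Xmod X}) : ideal_pure X -> submod_closed W <->
  exists I : {pred k}, is_ideal I /\
    forall a : Xmod X, a \in W <-> ideal_mul I (subalg_mem X) (Xmod_val a).
Proof.
move=> pureX; split=> [subW|[I [_ WE]]]; last exact: ideal_mul_submod WE.
have idI := submod_scalars_ideal subW; exists (submod_scalars W); split=> // a.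
split=> [aW|]; last exact: ideal_mul_sub.
apply: (pureX _ idI); first exact: Xmod_valP.
apply: (submod_sub_ideal subW) aW => c h hI [b bW def_b].
pose c1 : Xmod X := (c%:A : Xsharp X) *: Xmod1 X.
have val_bc : Xmod_val (b - c1) = h.
  transitivity (Xmod_val b - Xmod_val c1) => //.
  by rewrite def_b scalar_act_val addrC addKr.
(* b - c 1 lies in X^+ and in I H^+, hence in I X^+ by purity. *)
have bcW : b - c1 \in W.
  apply: (ideal_mul_sub subW); apply: (pureX _ idI); first exact: Xmod_valP.
  by rewrite val_bc.
have [_ Wlin] := subW; have := Wlin (-1) _ _ bcW bW.
by rewrite scaleN1r opprB addrNK.
Qed.

(** If [W] contains c 1 with c nonzero, then c is invertible and [W] is everything. Otherwise the
    descent with the zero ideal gives W = 0. *)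
Lemma field_irreducible : ring_is_field k -> irreducible_mod (Xmod X).
Proof.
move=> kfield; split=> [|W subW].
  by exists (Xmod1 X); apply/eqP => /(congr1 val) /eqP; rewrite /= oner_eq0.
have [[c c_neq0 cW]|noW] := pselect (exists2 c, c != 0 & c \in submod_scalars W).
  right=> a; have [d dc1] := kfield c c_neq0.
  suff : ((d * c)%:A : Xsharp X) *: a \in W by rewrite dc1 !scale1r.
  apply: submod_scalars_act => //.
  have [I0 Ilin] := submod_scalars_ideal subW.
  by have := Ilin d c 0 cW I0; rewrite addr0.
left=> a aW; apply: val_inj => /=.
suff [s s0 ->] : ideal_mul (pred1 (0 : k)) predT (Xmod_val a).
  by apply: big1_seq => p /andP[_ /s0[/eqP-> _]]; apply: scale0r.
apply: (submod_sub_ideal subW) aW => c h [s s0 ->] [b bW def_b].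
apply/negPn/negP => c_neq0; apply: noW; exists c => //.
rewrite /submod_scalars unfold_in (_ : _ *: _ = b) //; apply: val_inj.
rewrite [LHS]scalar_act_val /= def_b big1_seq ?addr0 // => p /andP[_ /s0[/eqP-> _]].
exact: scale0r.
Qed.

End Submodules.

(** * Faithfulness of the Fock space *)

Section Faithful.
Variables (k : comNzRingType) (D : dualPair k).

(** This is the image of the tensor product of H^+ with H^-_n: only the right factor is graded. *)
Definition sharp_deg n (al : heis D) : Prop :=
  exists2 s : seq (Hp D * Hm D), (forall p, p \in s -> p.2 \in deg (Hm D) n) &
    al = \sum_(p <- s) p.1 # p.2.

Lemma sharp_degD n al be :
  sharp_deg n al -> sharp_deg n be -> sharp_deg n (al + be).
Proof.
move=> [s sn ->] [t tn ->]; exists (s ++ t); last by rewrite big_cat.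
by move=> p; rewrite mem_cat => /orP[/sn|/tn].
Qed.

Lemma nat_act_sum J (r : seq J) (P : pred J) (F : J -> heis D) b :
  nat_act (\sum_(j <- r | P j) F j) b = \sum_(j <- r | P j) nat_act (F j) b.
Proof.
apply: (big_morph (fun al => nat_act al b)) => [al be|]; first exact: nat_actDl.
exact: nat_act0l.
Qed.

Lemma sharp_deg_lt m n al b :
  (m < n)%N -> sharp_deg n al -> b \in deg (Hp D) m -> nat_act al b = 0.
Proof.
move=> ltmn [s sn ->] bm; rewrite nat_act_sum big1_seq // => p /andP[_ ps].
by rewrite nat_actE (radj_lt ltmn (sn p ps) bm) mulr0.
Qed.

(** In degree n, a # x sends w to the multiple of [a] by the pairing of x and w. With dual bases b_i
    of H^-_n and w_i of H^+_n, [al] is therefore the sum of the al(w_i) # b_i. *)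
Lemma sharp_deg_eq0 n al : sharp_deg n al ->
  (forall b, b \in deg (Hp D) n -> nat_act al b = 0) -> al = 0.
Proof.
move=> [s sn def_al] al0.
have [d [b [w [_ wn def_x]]]] :=
  dual_bases (deg_submod _ n) (deg_free _ n) (pair_perfect D n).
have [tl tr] := tens_bilinear (Hp D) (Hm D).
transitivity (\sum_i nat_act al (w i) # b i); last first.
  apply: big1 => i _; rewrite al0 //; have := sharpPl (-1) (0 : Hp D) 0 (b i).
  by rewrite scaleN1r oppr0 addr0 scaleN1r addNr.
rewrite def_al; transitivity (\sum_(p <- s) \sum_i (p.1 * radj p.2 (w i)) # b i).
  apply: eq_big_seq => p ps; rewrite {1}(def_x p.2 (sn p ps)).
  rewrite /sharp (linear_sum_of _ _ (tr _)); apply: eq_bigr => i _.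
  rewrite (radj_top (leqnn n) (sn p ps) (wn i)) -scalerAr mulr1.
  by rewrite (scalable_linear (tl _)) (scalable_linear (tr _)).
rewrite exchange_big; apply: eq_bigr => i _.
rewrite nat_act_sum /sharp (linear_sum_of _ _ (tl _)).
by apply: eq_bigr => p _; rewrite nat_actE.
Qed.

Lemma heis_decomp (al : heis D) : exists N (f : nat -> heis D),
  (forall n, sharp_deg n (f n)) /\
  forall M, (N <= M)%N -> al = \sum_(n < M) f n.
Proof.
elim/heis_ind: al => [|al be [N [f [fdeg def_al]]] [N' [g [gdeg def_be]]]|a x].
- exists 0, (fun=> 0); split=> [n|M _]; last by rewrite big1.
  by exists [::]; rewrite ?big_nil.
- exists (maxn N N'), (fun n => f n + g n); split=> [n|M]; first exact: sharp_degD.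
  by rewrite geq_max => /andP[/def_al-> /def_be->]; rewrite big_split.
have [N [f [fdeg def_x]]] := deg_decomp x.
exists N, (fun n => a # f n); split=> [n|M /def_x->].
  exists [:: (a, f n)]; last by rewrite big_seq1.
  by move=> p; rewrite inE => /eqP->; apply: fdeg.
have [_ tr] := tens_bilinear (Hp D) (Hm D).
by rewrite /sharp (linear_sum_of _ _ (tr a)).
Qed.

(** Strong induction on the degree: on [b] of degree n, components of [al] above n vanish and those
    below n are already 0, so [f n] alone must kill [b]. *)
Lemma Fock_faithful : faithful_mod (Fock D).
Proof.
move=> al al0; have [N [f [fdeg def_al]]] := heis_decomp al.
suff f0 n : f n = 0 by rewrite (def_al N) // big1.
have [m] := ubnP n; elim: m n => // m IHm n ltnm.
apply: (sharp_deg_eq0 (fdeg n)) => b bn.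
(* The bound [maxn N n.+1] makes the index n occur in the sum even when n is at least [N]. *)
have := al0 b; rewrite (def_al (maxn N n.+1) (leq_maxl _ _)).
have n_lt : (n < maxn N n.+1)%N by rewrite leq_max ltnSn orbT.
rewrite [_ *: _]nat_act_sum (bigD1 (Ordinal n_lt)) //= big1 ?addr0 // => j njn.
have [ltjn|ltnj|eqjn] := ltngtP j n.
- by rewrite IHm ?nat_act0l // (leq_trans ltjn).
- exact: sharp_deg_lt ltnj (fdeg j) bn.
by case/eqP: njn; apply: val_inj.
Qed.

End Faithful.

Unset Implicit Arguments.

Theorem theorem2p11 (k : comNzRingType) (D : dualPair k) (X : invariantSubalgebra D) :
  [/\ (ideal_pure X ->
         forall W : {pred Xmod X}, submod_closed W <->
           exists I : {pred k}, is_ideal I /\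
             forall a : Xmod X,
               a \in W <-> ideal_mul I (subalg_mem X) (Xmod_val a))
      /\ (ring_is_field k -> irreducible_mod (Xmod X)),
      lmod_iso (Xmod X) (induced (Hm_Xsharp X) (kminus (Hm D))),
      forall (V : lmodType (Xsharp X)) (v : V),
        lowest_weight_vacuum v -> generates v -> lmod_iso V (Xmod X) &
      (forall a : Hp D, a \in X) ->
        [/\ forall al : heis D, al \in Xsharp_mem X,
            bijective (fun a : Xmod X => Xmod_val a : Fock D)
              /\ (forall (al : Xsharp X) (a : Xmod X),
                    (Xmod_val (al *: a) : Fock D) =
                    Xsharp_val al *: (Xmod_val a : Fock D)) &
            faithful_mod (Fock D)]].
Proof.
split; first by split=> [pureX W|]; [apply: submod_idealP | apply: field_irreducible].
- exact: Xmod_iso_induced.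
- exact: vacuum_module_iso.
move=> Xfull; split; last exact: Fock_faithful.
- elim/heis_ind => [|al be|a x]; first exact: Xsharp_mem0.
    exact: Xsharp_memD.
  exact: Xsharp_mem_sharp.
(* The action on [Xmod X] is defined as the restriction of [nat_act], so compatibility holds by
   computation. *)
- split=> //; exists (fun a => MkXmod (Xfull a)) => // a; exact: val_inj.
Qed.
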